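(* Let $X$ have the $\mathrm{EGLFR}(\alpha,\beta,a,b)$ distribution with $\beta>0$ and $b>0$, and let $r$ be a positive integer. Then $$E(X^r)=\sum_{n=0}^{\infty}\sum_{m=0}^{\infty}\sum_{k=0}^{m}\frac{\alpha}{2^k}(-1)^{m+n}\Lambda_{[n,m,k]}\,\beta^m a^{m-k}b^k\psi^{j}\left(\frac aj+\frac{b\psi}{j+1}\right),$$ where $j=m+k+r+1$ and $\Lambda_{[n,m,k]}=\binom{\alpha-1}{n}\binom{\frac{n+1}{\beta}-1}{m}\binom mk$.
   Context: Let $\alpha>0$, $\beta>0$, $a\ge0$, $b>0$. The extended generalized linear failure rate distribution $\mathrm{EGLFR}(\alpha,\beta,a,b)$ has cumulative distribution function $F(x)=\left(1-\left(1-\beta\left(ax+\tfrac b2x^2\right)\right)^{1/\beta}\right)^{\alpha}$ on its support $(0,\psi)$, where $\psi=\frac1b\sqrt{a^2+\frac{2b}{\beta}}-\frac ab$. For real $y$ and integer $n\ge0$, $\binom yn=\frac{y(y-1)\cdots(y-n+1)}{n!}$ is the generalized binomial coefficient; $0^0=1$. The multiple series is an iterated series, summed in the order displayed (innermost over $k$, then $m$, then $n$). *)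

(* Defs.v *)
From mathcomp Require Import all_boot all_order all_algebra.
From mathcomp Require Import all_classical all_reals all_analysis.
Set Implicit Arguments.
Unset Strict Implicit.
Unset Printing Implicit Defensive.
Import Order.TTheory GRing.Theory Num.Theory.
Import numFieldNormedType.Exports.
Local Open Scope classical_set_scope.
Local Open Scope ring_scope.

Definition gbinom (R : realType) (y : R) (n : nat) : R :=
  (\prod_(i < n) (y - i%:R)) / n`!%:R.

(* The right endpoint of the support: for 0 < beta and 0 < b, the positive root
   of 1 - beta * (a x + b / 2 x ^ 2). *)
Definition eglfr_psi (R : realType) (beta a b : R) : R :=
  b^-1 * Num.sqrt (a ^+ 2 + 2 * b / beta) - a / b.

(* The closed formula is the cdf on the support ]0, psi[ only; outside of it,
   [`^] would be applied to a negative base, where it carries no meaning. *)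
Definition eglfr_cdf (R : realType) (alpha beta a b x : R) : R :=
  if x <= 0 then 0
  else if x < eglfr_psi beta a b then
    (1 - (1 - beta * (a * x + b / 2 * x ^+ 2)) `^ beta^-1) `^ alpha
  else 1.

Definition has_eglfr d (T : measurableType d) (R : realType)
    (P : probability T R) (X : {RV P >-> R}) (alpha beta a b : R) : Prop :=
  forall x : R, cdf X x = (eglfr_cdf alpha beta a b x)%:E.

Definition eglfr_Lambda (R : realType) (alpha beta : R) (n m k : nat) : R :=
  gbinom (alpha - 1) n * gbinom (n.+1%:R / beta - 1) m * 'C(m, k)%:R.

Definition eglfr_term (R : realType) (alpha beta a b : R) (r n m k : nat) : R :=
  let psi := eglfr_psi beta a b in
  let j := (m + k + r + 1)%N in
  alpha / 2 ^+ k * (-1) ^+ (m + n)%N * eglfr_Lambda alpha beta n m k *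
  beta ^+ m * a ^+ (m - k)%N * b ^+ k * psi ^+ j *
  (a / j%:R + b * psi / j.+1%:R).

(* Main.v *)
Require Import Defs.
From mathcomp Require Import all_boot all_order all_algebra.
From mathcomp Require Import all_classical all_reals all_analysis.
From mathcomp Require Import measurable_realfun zify ring lra.
Import Order.TTheory GRing.Theory Num.Theory.
Import numFieldNormedType.Exports.
Local Open Scope classical_set_scope.
Local Open Scope ring_scope.

(** Put [u x = beta * (a * x + b / 2 * x ^+ 2)], so that the survival function
    of [X] is [1 - (1 - w) `^ alpha] with [w = (1 - u) `^ beta^-1], both [u] and
    [w] taking values in [[0, 1]] on the support.  The density is unbounded
    near the endpoints, so it is avoided altogether: by the tail formula,
    [E(X^r)] is the integral over [y] in [[0, psi^r]] of the survival function
    at the [r]-th root of [y].  For [p > 0] the partial sums of the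
    binomial series of [(1 - t) `^ p] converge uniformly on [[0, 1]], the error
    being at most [|C(p - 1, M)|], which tends to [0].  Hence this series can be
    integrated termwise, first in powers of [w] (with [p = alpha]) and then in
    powers of [u] (with [p = (n + 1) / beta], since
    [w ^+ n.+1 = (1 - u) `^ p]).  The shift from [alpha] and [p] to [alpha - 1]
    and [p - 1] in the coefficients, and from the integrals of [u ^+ m.+1] to
    those of [x ^+ r * u' * u ^+ m], is the algebraic trace of an integration
    by parts. *)

(** * Generalized binomial coefficients: recurrences, alternating sums, decay *)

Lemma gbinom0 {R : realType} (y : R) : gbinom y 0 = 1.
Proof. by rewrite /gbinom big_ord0 fact0 divr1. Qed.

Lemma gbinomS {R : realType} (y : R) n :
  n.+1%:R * gbinom y n.+1 = (y - n%:R) * gbinom y n.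
Proof.
rewrite /gbinom big_ord_recr/= factS natrM; field.
by rewrite nat1r !pnatr_eq0 -lt0n fact_gt0.
Qed.

Lemma gbinomSS {R : realType} (y : R) n :
  n.+1%:R * gbinom y n.+1 = y * gbinom (y - 1) n.
Proof.
rewrite /gbinom big_ord_recl/= factS natrM subr0.
under eq_bigr do rewrite -[(bump _ _)%:R]/(1 + _)%:R natrD opprD addrA.
by field; rewrite nat1r !pnatr_eq0 -lt0n fact_gt0.
Qed.

(** Telescoping by Pascal's rule. The left side is the truncated binomial series at [t = 1]. *)
Lemma sum_gbinom {R : realType} (p : R) M :
  \sum_(0 <= m < M.+1) (-1) ^+ m * gbinom p m = (-1) ^+ M * gbinom (p - 1) M.
Proof.
elim: M => [|M IH]; first by rewrite big_nat1 !gbinom0.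
rewrite big_nat_recr//= IH.
have n0 : M.+1%:R != 0 :> R by rewrite pnatr_eq0.
apply: (mulfI n0); rewrite mulrDr 2![M.+1%:R * (_ ^+ M.+1 * _)]mulrCA.
rewrite gbinomSS gbinomS exprS -natr1; ring.
Qed.

(* [q n = |C(p - 1, n)|] eventually decreases, with [q n - q n.+1 = p / n.+1 *
  q n];
   a positive limit would bound the harmonic series. *)
Lemma gbinom_cvg0 {R : realType} (p : R) : 0 < p ->
  gbinom (p - 1) n @[n --> \oo] --> 0.
Proof.
move=> p0; apply/norm_cvg0P.
pose q : R^nat := fun n => `|gbinom (p - 1) n|; rewrite -/q.
(* From [N] on the factor [p - 1 - n] is nonpositive, so absolute values satisfy
   [q n.+1 = (n.+1 - p) / n.+1 * q n]. *)
have [N pN] : exists N : nat, p <= N%:R.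
  by exists (Num.trunc p).+1; rewrite ltW// truncnS_gt.
have qS n : (N <= n)%N -> q n - q n.+1 = p / n.+1%:R * q n.
  move=> Nn; have n1 : 0 < n.+1%:R :> R by [].
  have pn : p <= n.+1%:R by rewrite (le_trans pN)// ler_nat ltnW.
  have -> : q n.+1 = (n.+1%:R - p) / n.+1%:R * q n.
    apply: (mulfI (lt0r_neq0 n1)).
    rewrite /q -[X in X * _ = _]gtr0_norm// -normrM gbinomS normrM.
    rewrite ler0_norm -?natr1; last by move: pn; rewrite -natr1; lra.
    by field; rewrite natr1 lt0r_neq0.
  by field; rewrite -?natr1 in n1 *; rewrite lt0r_neq0.
have q_ge0 n : 0 <= q n by exact: normr_ge0.
have qni n : (N <= n)%N -> q n.+1 <= q n.
  by move=> /qS E; rewrite -subr_ge0 E mulr_ge0// divr_ge0// ltW.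
pose s : R^nat := fun k => q (k + N)%N.
have sni : nonincreasing_seq s.
  by apply/nonincreasing_seqP => k; rewrite /s addSn qni// leq_addl.
have cs : cvgn s.
  by apply: nonincreasing_is_cvgn => //; exists 0 => _ [k _ <-]; exact: q_ge0.
have Ls k : limn s <= s k by exact: nonincreasing_cvgn_ge.
rewrite -(cvg_shiftn N) /=.
have : 0 <= limn s by apply: limr_ge => //; near=> k; exact: q_ge0.
rewrite le_eqVlt => /predU1P[L0|L0]; first by move: cs; rewrite -L0.
exfalso; apply: (@dvg_harmonic R).
apply: nondecreasing_is_cvgn.
  by apply/nondecreasing_seqP => n;
    rewrite /series/= big_nat_recr//= lerDl invr_ge0.
exists (series harmonic N + q N / (p * limn s)) => _ [n _ <-].
have pL : 0 < p * limn s by exact: mulr_gt0.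
rewrite -(ler_pM2l pL) mulrDr [X in _ + X]mulrC divfK ?lt0r_neq0//.
(* Telescoping: each drop [s k - s k.+1] is [p / (k + N).+1 * s k], hence at least [p * limn s]
   times the harmonic term of index [k + N]. *)
have H k : p * limn s * series harmonic (k + N)%N + s k <=
    p * limn s * series harmonic N + q N.
  elim: k => [|k IH]; first by rewrite /s add0n.
  apply: le_trans IH; rewrite addSn /series/= big_nat_recr//=.
  have := qS (k + N)%N (leq_addl _ _);
    rewrite -/(s k) -[q (_.+1)]/(s k.+1) => E.
  rewrite mulrDr -addrA lerD2l -lerBrDr.
  rewrite E [leRHS]mulrAC ler_wpM2r ?invr_ge0//.
  by rewrite ler_wpM2l// ltW.
have [nN|/ltnW nN] := leqP N n.
  by have := H (n - N)%N; rewrite subnK//; have := q_ge0 (n - N + N)%N;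
    rewrite -/(s _); lra.
apply: (@le_trans _ _ (p * limn s * series harmonic N)); last by rewrite lerDl.
rewrite ler_wpM2l//; first by rewrite ltW// mulr_gt0.
by rewrite /series/= (big_cat_nat _ nN)//= lerDl sumr_ge0// => i _;
  rewrite invr_ge0.
Unshelve. all: by end_near. Qed.

(** * Uniform error bound for the truncated binomial series on [[0, 1]] *)

Definition binomial_poly {R : realType} (p : R) M : {poly R} :=
  \sum_(0 <= m < M.+1) ((-1) ^+ m * gbinom p m) *: 'X^m.

(** The [p]-th power of [1 - t] solves [(1 - t) y' + p y = 0]. For its truncation the coefficients
    still cancel in every degree but the top one, where the next coefficient is missing. *)
Lemma binomial_poly_ode {R : realType} (p : R) M :
  (1 - 'X) * (binomial_poly p M)^`() + p *: binomial_poly p M =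
  (p * ((-1) ^+ M * gbinom (p - 1) M)) *: 'X^M.
Proof.
elim: M => [|M IH].
  by rewrite /binomial_poly big_nat1 !gbinom0 !mul1r scale1r derivXn mulr0
    add0r mulr1.
set e := (-1) ^+ M.+1 * gbinom p M.+1; set q := p * _ in IH.
have -> : binomial_poly p M.+1 = binomial_poly p M + e *: 'X^(M.+1).
  by rewrite /binomial_poly big_nat_recr.
have eq : M.+1%:R * e = - q by rewrite mulrCA gbinomSS exprS /q; ring.
have -> : p * ((-1) ^+ M.+1 * gbinom (p - 1) M.+1) = p * e + q.
  rewrite mulrCA -gbinomSS gbinomS -[q]opprK -eq /e; ring.
clearbody e q; rewrite derivD derivZ derivXn /= scalerDr mulrDr addrACA IH.
rewrite -scaler_nat scalerA [e * _]mulrC eq exprS -!mul_polyC !rmorphD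
  !rmorphM/= !rmorphN/=.
ring.
Qed.

Lemma is_derive_onem_powR {R : realType} (p x : R) : x < 1 ->
  is_derive x 1 (fun y => (1 - y) `^ p) (- (p * (1 - x) `^ (p - 1))).
Proof.
move=> x1; have x1' : 0 < 1 - x by rewrite subr_gt0.
have H := is_derive1_powR p x1'.
have D : is_derive x 1 (fun y => 1 - y) (-1 : R).
  by have := is_deriveB (is_derive_cst (1 : R) x 1) (is_derive_id x 1);
    rewrite sub0r.
by have := @is_derive1_comp _ (fun y : R => y `^ p) (fun y => 1 - y) x _ _ H
  D; rewrite mulrN1.
Qed.

(** Multiplying by the integrating factor, the power [- p] of [1 - x], turns [binomial_poly_ode]
    into the monotonicity of a function [f] on [[0, t]]; [f 0 <= f t] then gives the bound. The
    factor is singular at [t = 1], where [sum_gbinom] yields the error exactly. *)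
Lemma binomial_poly_bound {R : realType} (p t : R) M : 0 < p -> 0 <= t <= 1 ->
  `|(binomial_poly p M).[t] - (1 - t) `^ p| <= `|gbinom (p - 1) M|.
Proof.
move=> p0 /andP[t0]; rewrite le_eqVlt => /predU1P[->|t1].
  rewrite subrr powR0 ?gt_eqF// subr0 /binomial_poly horner_sum.
  under eq_bigr do rewrite hornerZ hornerXn expr1n mulr1.
  by rewrite sum_gbinom normrMsign.
set S := binomial_poly p M; set c := (-1) ^+ M * gbinom (p - 1) M.
have -> : `|gbinom (p - 1) M| = `|c| by rewrite /c normrMsign.
(* The cases [s = 1] and [s = -1] are the two sides of the absolute value. *)
have main (s : R) : `|s| <= 1 -> s * ((1 - t) `^ p - S.[t]) <= `|c|.
  move=> s1.
  (* By [binomial_poly_ode], the derivative of [f] has the sign of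
     [`|c| + s * (c * x ^+ M)], which is nonnegative. *)
  pose f x := (`|c| + s * S.[x]) * (1 - x) `^ (- p).
  have df (x : R) : x < 1 -> is_derive x 1 f ((`|c| + s * (c * x ^+ M)) *
      (p * (1 - x) `^ (- p - 1))).
    move=> x1.
    have dS := is_derive_poly S x.
    have dh := is_derive_onem_powR (- p) _ x1.
    have ode : (1 - x) * S^`().[x] + p * S.[x] = p * c * x ^+ M.
      by have /(congr1 (horner^~ x)) := binomial_poly_ode p M; rewrite !hornerE.
    have hE : (1 - x) `^ (- p) = (1 - x) * (1 - x) `^ (- p - 1).
      have x0 : 0 < 1 - x by rewrite subr_gt0.
      have x0' : 1 - x != 0 by rewrite gt_eqF.
      have -> : (1 - x) `^ (- p - 1) = (1 - x) `^ (- p) / (1 - x) `^ 1.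
        by apply: powRB; rewrite x0' implybT.
      by rewrite powRr1 ?ltW// mulrC divfK.
    have dcS : is_derive x 1 (fun y => `|c| + s * S.[y]) (s * S^`().[x]).
      have := is_deriveD (is_derive_cst `|c| x 1) (is_deriveZ s dS).
      by rewrite add0r.
    have := is_deriveM dcS dh; rewrite /f.
    set k := _ `^ (- p - 1) in hE *; rewrite hE => D.
    apply: (is_derive_eq D); rewrite /GRing.scale/=.
    have -> : c * x ^+ M = ((1 - x) * S^`().[x] + p * S.[x]) / p.
      by rewrite ode; field; rewrite gt_eqF.
    by field; rewrite gt_eqF.
  have : f 0 <= f t.
    have dft x : x \in `[0, t]%R -> derivable f x 1.
      move=> xt; have /df D : x < 1 by rewrite (le_lt_trans _ t1)// (itvP xt).
      by case: D.
    apply: (@ger0_derive1_le _ f 0 t _ _ true false) => //.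
    - by move=> x xt; apply: dft; exact: subset_itv_oo_cc xt.
    - move=> x xt; have x1 : x < 1 by rewrite (lt_trans _ t1)// (itvP xt).
      rewrite derive1E; have D := df x x1; rewrite derive_val.
      rewrite !mulr_ge0 ?powR_ge0 ?(ltW p0)//.
      have x0 : 0 <= x by rewrite (itvP xt).
      have : `|s * (c * x ^+ M)| <= `|c|.
        rewrite normrM [`|c * _|]normrM normrX (ger0_norm x0).
        rewrite (le_trans (ler_wpM2r _ s1)) ?mulr_ge0 ?exprn_ge0// mul1r.
        by rewrite ler_piMr// exprn_ile1// ltW.
      by rewrite ler_norml => /andP[]; lra.
    - exact: derivable_within_continuous.
    - by rewrite in_itv/= lexx.
    - by rewrite in_itv/= lexx t0.
  have S0 : S.[0] = 1.
    rewrite /S /binomial_poly horner_sum big_nat_recl//= big1 => [|i _].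
      by rewrite hornerZ hornerXn !expr0 gbinom0 addr0 !mulr1.
    by rewrite hornerZ hornerXn expr0n mulr0.
  rewrite /f S0 subr0 powR1 powRN mulr1.
  have w0 : 0 < (1 - t) `^ p by rewrite powR_gt0 ?subr_gt0.
  rewrite ler_pdivlMr//.
  have : 0 <= `|c| * (1 - t) `^ p by rewrite mulr_ge0// ltW.
  lra.
rewrite ler_norml; have := main 1; have := main (-1);
  rewrite normrN normr1 lexx; lra.
Qed.

(** * Termwise integration over a set of finite measure *)

Section bounded_integrals.
Context d (T : measurableType d) (R : realType).
Variables (mu : {measure set T -> \bar R}) (D : set T) (g : T -> R) (K : R).
Hypotheses (mD : measurable D) (finD : (mu D < +oo)%E).
Hypotheses (mg : measurable_fun D g) (gK : forall x, D x -> `|g x| <= K).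

Lemma measurable_le_integrable (f : T -> R) (k : R) : measurable_fun D f ->
  (forall x, D x -> `|f x| <= k) -> mu.-integrable D (EFin \o f).
Proof.
move=> mf fk; apply: measurable_bounded_integrable => //.
exists k; split; first exact: num_real.
by move=> M kM x /fk fxk /=; rewrite (le_trans fxk)// ltW.
Qed.

Lemma integrable_expr m : mu.-integrable D (EFin \o (fun x => g x ^+ m)).
Proof.
apply: (measurable_le_integrable _ (K ^+ m)); first exact: measurable_funX.
by move=> x /gK gx; rewrite normrX lerXn2r// nnegrE (le_trans _ gx).
Qed.

Lemma integrable_scale_sum_expr (c : R^nat) n : mu.-integrable D
  (EFin \o (fun x => \sum_(0 <= m < n) c m * g x ^+ m)).
Proof.
elim: n => [|n IH].
  rewrite (_ : _ \o _ = cst 0%E); first exact: integrable0.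
  by apply/funext => x /=; rewrite big_geq.
rewrite (_ : _ \o _ = (EFin \o (fun x => \sum_(0 <= m < n) c m * g x ^+ m)%R) \+
  (fun x => (c n)%:E * (g x ^+ n)%:E))%E.
  by apply: integrableD => //; apply: integrableZl => //;
    exact: integrable_expr.
by apply/funext => x /=; rewrite big_nat_recr//= EFinD EFinM.
Qed.

Lemma Rintegral_scale_sum_expr (c : R^nat) n :
  (\int[mu]_(x in D) (\sum_(0 <= m < n) c m * g x ^+ m) =
   \sum_(0 <= m < n) c m * \int[mu]_(x in D) (g x ^+ m))%R.
Proof.
elim: n => [|n IH].
  under eq_Rintegral do rewrite big_geq//.
  by rewrite Rintegral_cst// mul0r big_geq.
under eq_Rintegral do rewrite big_nat_recr//=.
rewrite big_nat_recr//= RintegralD// ?RintegralZl ?IH//; [| |].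
- exact: integrable_expr.
- exact: integrable_scale_sum_expr.
- have := integrableZl mD (c n) (integrable_expr n).
  by apply: eq_integrable => // x _; rewrite /= EFinM.
Qed.

End bounded_integrals.

Lemma cvg_series_gbinom_Rintegral d (T : measurableType d) (R : realType)
    (mu : {measure set T -> \bar R}) (D : set T) (g : T -> R) (p : R) :
  measurable D -> (mu D < +oo)%E -> measurable_fun D g ->
  (forall x, D x -> 0 <= g x <= 1) -> 0 < p ->
  series (fun m => (-1) ^+ m * gbinom p m * \int[mu]_(x in D) (g x ^+ m))%R @
    \oo
    --> (\int[mu]_(x in D) ((1 - g x) `^ p))%R.
Proof.
(* The shift accounts for [binomial_poly p M] having [M.+1] terms. *)
move=> mD finD mg g01 p0; rewrite -cvg_shiftS; apply/subr_cvg0.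
have g1 x : D x -> `|g x| <= 1 by move=> /g01/andP[g0 gx1]; rewrite ger0_norm.
have isum := integrable_scale_sum_expr _ _ _ mu D g 1 mD finD mg g1.
have ile := measurable_le_integrable _ _ _ mu D mD finD.
have ip : mu.-integrable D (EFin \o (fun x => (1 - g x) `^ p)).
  apply: (ile _ 1).
    apply: (measurableT_comp (measurable_powR _)).
    exact: measurable_funB.
  move=> x /g01 /andP[g0 gx1]; rewrite ger0_norm ?powR_ge0//.
  have e1 : (1 : R) `^ p = 1 by rewrite powR1.
  rewrite -[leRHS]e1 ge0_ler_powR ?nnegrE ?(ltW p0)//; lra.
pose q := fun n => `|gbinom (p - 1) n| * fine (mu D).
apply/norm_cvg0P.
apply: (@squeeze_cvgr _ _ _ _ (cst 0) q).
- near=> M; rewrite normr_ge0 /=.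
  rewrite /series/= -(Rintegral_scale_sum_expr _ _ _ mu D g 1 mD finD mg g1).
  rewrite -RintegralB//.
  have iB := integrableB mD (isum (fun m => (-1) ^+ m * gbinom p m) M.+1) ip.
  apply: (le_trans (le_normr_Rintegral _ _)) => //.
  rewrite /q -(Rintegral_cst mu mD); apply: le_Rintegral => //.
  + exact: integrable_norm.
  + apply: (ile _ `|gbinom (p - 1) M|) => //.
    by move=> x _; rewrite normr_id.
  + move=> x Dx.
    have := binomial_poly_bound p (g x) M p0 (g01 x Dx).
    rewrite /binomial_poly horner_sum.
    by under eq_bigr do rewrite hornerZ hornerXn.
- exact: cvg_cst.
- rewrite -(mul0r (fine (mu D))); apply: cvgMr_tmp.
  by apply/norm_cvg0P/gbinom_cvg0.
Unshelve. all: by end_near. Qed.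

(** * Integrals of real powers over [[0, A]] *)

Lemma powR_cvg_at_right0 {R : realType} (s : R) : 0 <= s ->
  x `^ s @[x --> (0:R)^'+] --> (0 : R) `^ s.
Proof.
rewrite le_eqVlt => /predU1P[<-|s0].
  rewrite powRr0; under eq_fun do rewrite powRr0; exact: cvg_cst.
by rewrite powR0 ?gt_eqF//; exact: powR_cvg0.
Qed.

Lemma powR_continuous_gt0 {R : realType} (s x : R) : 0 < x ->
  {for x, continuous (fun y : R => y `^ s)}.
Proof.
move=> x0; apply/differentiable_continuous/derivable1_diffP.
by apply: derivable_powR; rewrite in_itv/= x0.
Qed.

Lemma powR_continuous_bnd {R : realType} (s A : R) : 0 <= s -> 0 < A ->
  [/\ {in `]0, A[, continuous (fun y : R => y `^ s)},
      x `^ s @[x --> (0:R)^'+] --> (0 : R) `^ s & 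
      x `^ s @[x --> A^'-] --> A `^ s].
Proof.
move=> s0 A0; split.
- by move=> x xA; apply: powR_continuous_gt0; rewrite (itvP xA).
- exact: powR_cvg_at_right0.
- exact/cvg_at_left_filter/powR_continuous_gt0.
Qed.

Lemma Rintegral_powR {R : realType} (s A : R) : 0 <= s -> 0 < A ->
  \int[lebesgue_measure]_(y in `[0, A]) (y `^ s) = A `^ (s + 1) / (s + 1).
Proof.
move=> s0 A0; have s1 : 0 < s + 1 by lra.
have [cs s_r s_l] := powR_continuous_bnd s A s0 A0.
have [cs1 s1_r s1_l] := powR_continuous_bnd (s + 1) A (ltW s1) A0.
rewrite /Rintegral (@continuous_FTC2 _ _ (fun y => y `^ (s + 1) / (s + 1)))//.
- by rewrite powR0 ?gt_eqF// mul0r sube0.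
- by apply/continuous_within_itvP.
- split.
  + move=> x xA; apply: derivableM; last exact: derivable_cst.
    by apply: derivable_powR; rewrite in_itv/= (itvP xA).
  + by apply: cvgMr_tmp.
  + by apply: cvgMr_tmp.
- move=> x xA; have x0 : 0 < x by rewrite (itvP xA).
  rewrite derive1E.
  have [_] := is_deriveM (is_derive1_powR (s + 1) x0) (is_derive_cst (s +
    1)^-1 x 1).
  by rewrite scaler0 add0r addrK => ->;
    rewrite /GRing.scale/= mulrA mulVf ?gt_eqF// mul1r.
Qed.

(** The right side is the integral of [r * x ^+ r.-1 * x ^+ i] over [[0, psi]], as the substitution
    [y = x ^+ r] predicts. Integrating the power [i / r] of [y] directly replaces that
    substitution. *)
Lemma Rintegral_root_expr {R : realType} (psi : R) (r i : nat) : 0 < psi ->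
  (0 < r)%N ->
  \int[lebesgue_measure]_(y in `[0, psi ^+ r]) ((y `^ r%:R^-1) ^+ i) =
  r%:R * psi ^+ (r + i) / (r + i)%:R.
Proof.
move=> psi0 r0; have r0' : r%:R != 0 :> R by rewrite pnatr_eq0 -lt0n.
transitivity (\int[lebesgue_measure]_(y in `[0, psi ^+ r]) (y `^ (i%:R /
  r%:R)) : R).
  apply: eq_Rintegral => y _.
  by rewrite -powR_mulrn ?powR_ge0// -powRrM mulrC.
rewrite Rintegral_powR ?divr_ge0// ?exprn_gt0//.
rewrite -powR_mulrn ?ltW// -powRrM.
have -> : r%:R * (i%:R / r%:R + 1) = (r + i)%:R :> R by rewrite natrD; field.
rewrite powR_mulrn ?ltW// natrD; field.
by rewrite r0' -natrD pnatr_eq0 -lt0n ltn_addr.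
Qed.

(** * Integration of polynomials through their coefficients *)

(** The linear functional sending ['X^i] to [w i] for [i < N]. For [w] a sequence of moments it
    integrates every polynomial of size at most [N]. *)
Definition coef_comb {R : realType} (w : R^nat) N (p : {poly R}) : R :=
  \sum_(0 <= i < N) p`_i * w i.

Lemma coef_comb_sum {R : realType} (w : R^nat) N (I : Type) (s : seq I)
    (F : I -> {poly R}) :
  coef_comb w N (\sum_(k <- s) F k) = \sum_(k <- s) coef_comb w N (F k).
Proof.
rewrite /coef_comb exchange_big/=; apply: eq_bigr => i _.
by rewrite coef_sum mulr_suml.
Qed.

Lemma coef_combD {R : realType} (w : R^nat) N (p q : {poly R}) :
  coef_comb w N (p + q) = coef_comb w N p + coef_comb w N q.
Proof. by rewrite /coef_comb -big_split; apply: eq_bigr => i _;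
  rewrite coefD mulrDl. Qed.

Lemma coef_combZ {R : realType} (w : R^nat) N (c : R) (p : {poly R}) :
  coef_comb w N (c *: p) = c * coef_comb w N p.
Proof. by rewrite /coef_comb mulr_sumr; apply: eq_bigr => i _;
  rewrite coefZ mulrA. Qed.

Lemma coef_combXn {R : realType} (w : R^nat) N i : (i < N)%N ->
  coef_comb w N 'X^i = w i.
Proof.
move=> iN; rewrite /coef_comb (bigD1_seq i) ?mem_index_iota ?iota_uniq//=.
rewrite coefXn eqxx mul1r big1 ?addr0// => k /negbTE ki.
by rewrite coefXn ki mul0r.
Qed.

(* With [w i] the integral of [r * x ^+ r.-1 * x ^+ i] (on the left) or of
   [x ^+ r * x ^+ i] (on the right) over [[0, psi]], this is integration by
   parts for polynomials. *)
Lemma coef_comb_by_parts {R : realType} (psi : R) r N (p : {poly R}) :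
  (0 < r)%N -> (size p <= N.+1)%N ->
  coef_comb (fun i => r%:R * psi ^+ (r + i) / (r + i)%:R) N.+1 p =
  psi ^+ r * p.[psi] -
  coef_comb (fun i => psi ^+ (r + i).+1 / (r + i).+1%:R) N p^`().
Proof.
move=> r0 sp; rewrite (horner_coef_wide _ sp) -(big_mkord xpredT (fun i =>
  p`_i * psi ^+ i)).
rewrite /coef_comb !big_nat_recl//= addn0 expr0 mulr1 mulrDr -addrA;
  congr (_ + _).
  by field; rewrite pnatr_eq0 -lt0n.
rewrite mulr_sumr -sumrB; apply: eq_bigr => i _.
rewrite coef_deriv addnS -mulr_natr exprS exprD exprS.
(* This splits [r / (r + i).+1] into [1], the boundary term, minus [i.+1 / (r + i).+1], the term of
   the derivative. *)
have -> : r%:R = (r + i).+1%:R - i.+1%:R :> R by rewrite -natrB ?subSS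
  ?addnK// ltnS leq_addl.
by field; rewrite -natrD nat1r.
Qed.

(** * The polynomial [u] and its moments *)

(* [beta] times the cumulative hazard of the linear failure rate
   distribution. *)
Definition hazard_poly {R : realType} (beta a b : R) : {poly R} :=
  'X * ((beta * a)%:P + (beta * (b / 2)) *: 'X).

Lemma horner_hazard_poly {R : realType} (beta a b x : R) :
  (hazard_poly beta a b).[x] = beta * (a * x + b / 2 * x ^+ 2).
Proof. by rewrite /hazard_poly !(hornerM, hornerD, hornerX, hornerC, hornerZ);
  ring. Qed.

Lemma deriv_hazard_poly {R : realType} (beta a b : R) :
  (hazard_poly beta a b)^`() = beta *: (a%:P + b *: 'X).
Proof.
rewrite derivM derivX derivD derivC derivZ derivX add0r mul1r.
have -> : b *: 'X = (b / 2 + b / 2) *: 'X by rewrite -splitr.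
rewrite -!mul_polyC polyCD !polyCM; ring.
Qed.

Lemma size_hazard_poly_exp {R : realType} (beta a b : R) m :
  (size (hazard_poly beta a b ^+ m) <= (2 * m).+1)%N.
Proof.
have s3 : (size (hazard_poly beta a b) <= 3)%N.
  rewrite (leq_trans (size_polyMleq _ _))// size_polyX/=.
  rewrite ltnS (leq_trans (size_polyD _ _))// geq_max (leq_trans
    (size_polyC_leq1 _))//.
  by rewrite (leq_trans (size_scale_leq _ _))// size_polyX.
rewrite (leq_trans (size_poly_exp_leq _ _))// ltnS leq_mul2r.
by apply/orP; right; case: (size _) s3 => [|[|[|[]]]].
Qed.

(* The integral over [[0, psi]] of [x ^+ r * (a + b * x) * u x ^+ m], where
   [u = hazard_poly beta a b]; the bound [(2 * m).+2] exceeds the degree of the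
   polynomial. *)
Definition hazard_moment {R : realType} (a b psi beta : R) r m : R :=
  coef_comb (fun i => psi ^+ (r + i).+1 / (r + i).+1%:R) (2 * m).+2
    ((a%:P + b *: 'X) * hazard_poly beta a b ^+ m).

(** The sum over [k] is the binomial expansion of [u ^+ m], with
    [u = x * (beta * a + beta * (b / 2) * x)]. Integrating [x ^+ r * (a + b * x) * x ^+ (m + k)]
    produces the factor with denominators [j] and [j.+1], and [b / 2] produces the powers of [2]. *)
Lemma hazard_momentE {R : realType} (alpha beta a b : R) r n m :
  \sum_(0 <= k < m.+1) eglfr_term alpha beta a b r n m k =
  alpha * ((-1) ^+ n * gbinom (alpha - 1) n) *
  ((-1) ^+ m * gbinom (n.+1%:R / beta - 1) m *
   hazard_moment a b (eglfr_psi beta a b) beta r m).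
Proof.
set psi := eglfr_psi _ _ _.
rewrite /hazard_moment /hazard_poly exprMn exprDn -(big_mkord xpredT
  (fun k => (beta * a)%:P ^+ (m - k) * (beta * (b / 2) *: 'X) ^+ k *+ 'C(m,
    k))).
have -> : (a%:P + b *: 'X) * ('X^m * \sum_(0 <= k < m.+1)
    (beta * a)%:P ^+ (m - k) * (beta * (b / 2) *: 'X) ^+ k *+ 'C(m, k)) =
  \sum_(0 <= k < m.+1) (beta ^+ m * a ^+ (m - k) * (b / 2) ^+ k * 'C(m, k)%:R)
    *:
    (a *: 'X^(m + k) + b *: 'X^((m + k).+1)).
  rewrite mulrA mulr_sumr; apply: eq_big_nat => k /= km.
  have bm : beta ^+ m = beta ^+ (m - k) * beta ^+ k by rewrite -exprD subnK//;
    lia.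
  rewrite bm exprZn -polyC_exp !exprMn -mulr_natr -polyC_natr exprS exprD.
  rewrite -!mul_polyC !polyCM; ring.
rewrite coef_comb_sum !mulr_sumr; apply: eq_big_nat => k /= km.
rewrite coef_combZ coef_combD !coef_combZ !coef_combXn ?ltnS; [|lia..].
rewrite /eglfr_term -/psi /eglfr_Lambda.
have -> : (r + (m + k)).+1 = (m + k + r + 1)%N by lia.
have -> : (r + (m + k).+1).+1 = (m + k + r + 1).+1 by lia.
rewrite exprD exprMn exprVn exprS.
field.
by rewrite -!natrD !natr1 nat1r -natrX !pnatr_eq0 expn_eq0.
Qed.

(** * Tail formula for the moments *)

Lemma expectation_expr_ccdf d (T : measurableType d) (R : realType)
    (P : probability T R) (X : {RV P >-> R}) (r : nat) : (0 < r)%N ->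
  cdf X 0 = 0%E ->
  ('E_P[fun w => (X w ^+ r)%R] =
   \int[lebesgue_measure]_(y in `[0%R, +oo[) ccdf X (y `^ r%:R^-1))%E.
Proof.
move=> r0 X0.
have r_neq0 : r%:R != 0 :> R by rewrite pnatr_eq0 -lt0n.
(* [X] is positive almost surely, so truncating at [0] keeps the expectation. It makes the variable
   nonnegative everywhere, and for every [r], even ones included, [Y w > y] becomes equivalent to
   [X w] exceeding the root of [y]. *)
pose Y w := Num.max (X w) 0 ^+ r.
have mY : measurable_fun [set: T] Y.
  by apply: measurable_funX; apply: measurable_maxr.
pose Z : {RV P >-> R} := mfun_Sub (mem_set mY).
have -> : ('E_P[fun w => (X w ^+ r)%R] = 'E_P[Z])%E.
  rewrite unlock; apply: ae_eq_integral => //.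
  - by apply/measurable_EFinP; exact: measurable_funX.
  - exact/measurable_EFinP.
  - exists (X @^-1` `]-oo, 0]); split.
    + by rewrite -[X in measurable X]setTI; exact: measurable_funPT.
    + exact: X0.
    + move=> w /= /not_implyP[_ neq]; rewrite in_itv/= leNgt; apply/negP => Xw.
      by apply: neq; rewrite /Y max_l// ltW.
rewrite ge0_expectation_ccdf; last first.
  by move=> w /=; rewrite exprn_ge0// le_max lexx orbT.
apply: eq_integral => y; rewrite inE/= in_itv/= andbT => y0.
rewrite /ccdf /distribution /pushforward; congr (P _).
apply/seteqP; split=> w /=; rewrite !in_itv/= !andbT.
- have M0 : 0 <= Num.max (X w) 0 by rewrite le_max lexx orbT.
  move=> /(gt0_ltr_powR (_ : 0 < r%:R^-1)); rewrite invr_gt0 ltr0n => /(_ r0).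
  rewrite !nnegrE /Y exprn_ge0// => /(_ y0 isT).
  rewrite -powR_mulrn// -powRrM divff// powRr1// lt_max => /orP[//|].
  by rewrite ltNge powR_ge0.
- move=> yX; have X_ge0 : 0 <= X w by rewrite (le_trans (powR_ge0 y
  r%:R^-1))// ltW.
  have -> : y = (y `^ r%:R^-1) ^+ r by rewrite -powR_mulrn ?powR_ge0// -powRrM
    mulVf// powRr1.
  by rewrite /Y max_l// ltrXn2r ?nnegrE ?powR_ge0// -lt0n.
Qed.

(** * The range of [u] on the support *)

Lemma eglfr_psi_gt0 {R : realType} (beta a b : R) :
  0 < beta -> 0 <= a -> 0 < b -> 0 < eglfr_psi beta a b.
Proof.
move=> beta0 a0 b0; rewrite /eglfr_psi subr_gt0 [ltRHS]mulrC ltr_pM2r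
  ?invr_gt0//.
rewrite -[ltLHS](ger0_norm a0) -sqrtr_sqr ltr_sqrt ?ltrDl ?ltr_pwDr ?sqr_ge0//.
all: by rewrite divr_gt0// mulr_gt0.
Qed.

Lemma horner_hazard_poly_psi {R : realType} (beta a b : R) :
  0 < beta -> 0 < b -> (hazard_poly beta a b).[eglfr_psi beta a b] = 1.
Proof.
move=> beta0 b0; rewrite horner_hazard_poly /eglfr_psi.
have : Num.sqrt (a ^+ 2 + 2 * b / beta) ^+ 2 = a ^+ 2 + 2 * b / beta.
  by rewrite sqr_sqrtr// addr_ge0 ?sqr_ge0// divr_ge0 ?mulr_ge0// ltW.
set s := Num.sqrt _ => s2.
(* Completing the square: [u x = beta / (2 * b) * ((a + b * x) ^+ 2 - a ^+ 2)], and
   [a + b * psi = s]. *)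
transitivity (beta / (2 * b) * (s ^+ 2 - a ^+ 2)); first by field;
  rewrite gt_eqF.
by rewrite s2; field; rewrite !gt_eqF.
Qed.

Lemma horner_hazard_poly_itv {R : realType} (beta a b x : R) :
  0 < beta -> 0 <= a -> 0 < b -> 0 <= x <= eglfr_psi beta a b ->
  0 <= (hazard_poly beta a b).[x] <= 1.
Proof.
move=> beta0 a0 b0 /andP[x0 xpsi].
rewrite -[X in _ && (_ <= X)](horner_hazard_poly_psi beta a b beta0 b0)
  !horner_hazard_poly.
have b2 : 0 <= b / 2 by rewrite divr_ge0// ltW.
have psi0 := le_trans x0 xpsi.
apply/andP; split; first by rewrite mulr_ge0 ?addr_ge0 ?mulr_ge0 ?sqr_ge0// ltW.
by rewrite ler_pM2l// lerD ?ler_wpM2l// lerXn2r ?nnegrE.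
Qed.

(** * The inner and outer series as integrals over [[0, psi ^+ r]] *)

Section eglfr_integrals.
Context {R : realType} (beta a b : R) (r : nat).
Hypotheses (beta0 : 0 < beta) (a0 : 0 <= a) (b0 : 0 < b) (r0 : (0 < r)%N).
Local Notation mu := (@lebesgue_measure R).
Local Notation psi := (eglfr_psi beta a b).
Local Notation D := `[0, psi ^+ r]%classic.
Local Notation u y := ((hazard_poly beta a b).[y `^ r%:R^-1]).

Let psi0 : 0 < psi. Proof. exact: eglfr_psi_gt0. Qed.
Let r_neq0 : r%:R != 0 :> R. Proof. by rewrite pnatr_eq0 -lt0n. Qed.

Let measurable_D : measurable (D : set R). Proof. exact: measurable_itv. Qed.

Let mu_D : mu D = (psi ^+ r)%:E.
Proof. by rewrite lebesgue_measure_itv/= lte_fin exprn_gt0// oppr0 adde0. Qed.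

Let mu_D_fin : (mu D < +oo)%E. Proof. by rewrite mu_D ltry. Qed.

Let root_itv y : D y -> 0 <= y `^ r%:R^-1 <= psi.
Proof.
rewrite /= in_itv/= => /andP[y0 ypsi]; rewrite powR_ge0/=.
have -> : psi = (psi ^+ r) `^ r%:R^-1.
  by rewrite -powR_mulrn ?ltW// -powRrM divff// powRr1// ltW.
by rewrite ge0_ler_powR// nnegrE exprn_ge0// ltW.
Qed.

Let measurable_u : measurable_fun D (fun y => u y).
Proof.
apply: (measurableT_comp (continuous_measurable_fun (@continuous_horner R _))).
exact: measurable_funTS (measurable_powR _).
Qed.

Let u01 y : D y -> 0 <= u y <= 1.
Proof. by move=> /root_itv; exact: horner_hazard_poly_itv. Qed.

(** Integration by parts in the variable [x]: the boundary term is [psi ^+ r] because [u psi = 1],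
    and [u' = beta * (a + b * x)] leads to [hazard_moment]. *)
Let Rintegral_u_expr m : \int[mu]_(y in D) (u y ^+ m.+1) =
  psi ^+ r - m.+1%:R * beta * hazard_moment a b psi beta r m.
Proof.
set q := hazard_poly beta a b ^+ m.+1.
have sq : (size q <= (2 * m).+3)%N.
  by rewrite (leq_trans (size_hazard_poly_exp _ _ _ _))//; lia.
transitivity (\int[mu]_(y in D) (\sum_(0 <= i < (2 * m).+3) q`_i * (y `^
  r%:R^-1) ^+ i) : R).
  apply: eq_Rintegral => y _.
  by rewrite -horner_exp (horner_coef_wide _ sq) big_mkord.
rewrite (Rintegral_scale_sum_expr _ _ _ mu D _ psi)//; first last.
- by move=> y /root_itv/andP[? ?]; rewrite ger0_norm.
- exact: measurable_funTS (measurable_powR _).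
under eq_bigr do rewrite Rintegral_root_expr//.
rewrite [LHS](coef_comb_by_parts psi r (2 * m).+2 q r0 sq).
rewrite horner_exp horner_hazard_poly_psi// expr1n mulr1; congr (_ - _).
rewrite /q deriv_exp deriv_hazard_poly /hazard_moment -[m.+1.-1]/m.
rewrite -scaler_nat -scalerAl !coef_combZ.
by rewrite -[RHS]mulrA.
Qed.

(** By [Rintegral_u_expr] and [gbinomSS], [n.+1] times the term of index [m] is
    [(-1) ^+ m.+1 * gbinom p m.+1] times the integral of [u ^+ m.+1] minus [psi ^+ r]. The integrals
    form the binomial series of [1 - u]; the constants sum, by [sum_gbinom], to a multiple of
    [gbinom (p - 1) M], which vanishes in the limit. *)
Lemma cvg_series_inner n :
  series (fun m => (-1) ^+ m * gbinom (n.+1%:R / beta - 1) m *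
                   hazard_moment a b psi beta r m) @ \oo -->
  (\int[mu]_(y in D) ((1 - u y) `^ (n.+1%:R / beta))) / n.+1%:R.
Proof.
set p := n.+1%:R / beta.
have p0 : 0 < p by rewrite divr_gt0.
have c1 := cvg_series_gbinom_Rintegral _ _ _ mu D (fun y => u y) p
  measurable_D mu_D_fin measurable_u u01 p0.
have c2 : (fun M => (-1) ^+ M * gbinom (p - 1) M : R) @ \oo --> (0 : R).
  apply/norm_cvg0P; under eq_fun do rewrite normrMsign.
  exact/norm_cvg0P/gbinom_cvg0.
rewrite -cvg_shiftS in c1.
rewrite (_ : series _ = fun M => (series (fun m => (-1) ^+ m * gbinom p m *
    \int[mu]_(y in D) (u y ^+ m)) M.+1 -
    (-1) ^+ M * gbinom (p - 1) M * psi ^+ r) / n.+1%:R).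
  have c3 : (fun M => (-1) ^+ M * gbinom (p - 1) M * psi ^+ r) @ \oo --> (0 :
    R).
    by have := cvgMr_tmp (b := psi ^+ r) c2; rewrite mul0r; apply.
  by apply: cvgMr_tmp; have := cvgB c1 c3; rewrite subr0; apply.
apply/funext => M.
rewrite /= -sum_gbinom /series/= !big_nat_recl//=.
(* The terms of index [0] of the two sums cancel, which absorbs the shift from [m] to [m.+1]. *)
have -> : (\int[mu]_(y in D) (u y ^+ 0)) = psi ^+ r :> R.
  under eq_Rintegral do rewrite expr0.
  by rewrite Rintegral_cst// mul1r (congr1 fine mu_D).
rewrite [(_ + _) * psi ^+ r]mulrDl opprD addrACA subrr add0r mulr_suml -sumrB
  mulr_suml.
apply: eq_bigr => m _.
rewrite Rintegral_u_expr.
have E := gbinomSS p m.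
have -> : gbinom (p - 1) m = m.+1%:R * gbinom p m.+1 / p.
  by rewrite E; field; rewrite gt_eqF.
rewrite /p exprS; field.
by rewrite nat1r pnatr_eq0 (gt_eqF beta0).
Qed.

Local Notation w y := ((1 - u y) `^ beta^-1).

Let powR_onem_le1 (x s : R) : 0 <= x <= 1 -> 0 <= s -> 0 <= (1 - x) `^ s <= 1.
Proof.
move=> /andP[x0 x1] s0; rewrite powR_ge0/=.
have e1 : (1 : R) `^ s = 1 by rewrite powR1.
by rewrite -[leRHS]e1 ge0_ler_powR ?nnegrE//; lra.
Qed.

Let w01 y : D y -> 0 <= w y <= 1.
Proof. by move=> /u01 u01y; rewrite powR_onem_le1 ?invr_ge0 ?(ltW beta0). Qed.

Let measurable_w : measurable_fun D (fun y => w y).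
Proof. apply: (measurableT_comp (measurable_powR _));
  exact: measurable_funB. Qed.

Let measurable_powR_onem_w (s : R) : measurable_fun D (fun y => (1 - w y) `^ s).
Proof. apply: (measurableT_comp (measurable_powR _));
  exact: measurable_funB. Qed.

Let integrable_powR_onem_w (s : R) : 0 <= s ->
  mu.-integrable D (EFin \o (fun y => (1 - w y) `^ s)).
Proof.
move=> s0; apply: (measurable_le_integrable _ _ _ mu D measurable_D mu_D_fin _
  1).
  exact: measurable_powR_onem_w.
move=> y /w01 w01y; have /andP[p0 p1] := powR_onem_le1 _ _ w01y s0.
by rewrite ger0_norm.
Qed.

Let integrable_survival (s : R) : 0 <= s ->
  mu.-integrable D (EFin \o (fun y => 1 - (1 - w y) `^ s)).
Proof.
move=> s0; apply: (measurable_le_integrable _ _ _ mu D measurable_D mu_D_fin _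
  1).
  by apply: measurable_funB => //; exact: measurable_powR_onem_w.
move=> y /w01 w01y; have /andP[p0 p1] := powR_onem_le1 _ _ w01y s0.
by rewrite ger0_norm ?subr_ge0// gerBl.
Qed.

Let integrable_cst1 : mu.-integrable D (EFin \o (fun=> 1)).
Proof.
apply: (measurable_le_integrable _ _ _ mu D measurable_D mu_D_fin _ 1) => // y
  _.
by rewrite normr1.
Qed.

(** Since [gbinom alpha n.+1 = alpha * gbinom (alpha - 1) n / n.+1], this is the binomial series in
    powers of [w] with its sign reversed and its term of index [0] removed; that term is the
    integral of the [1] in the survival function. *)
Lemma cvg_series_outer (alpha : R) : 0 < alpha ->
  series (fun n => alpha * ((-1) ^+ n * gbinom (alpha - 1) n) *
    (\int[mu]_(y in D) ((1 - u y) `^ (n.+1%:R / beta)) / n.+1%:R)) @ \oo -->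
  (\int[mu]_(y in D) (1 - (1 - (1 - u y) `^ beta^-1) `^ alpha) : R).
Proof.
move=> alpha0.
have c1 := cvg_series_gbinom_Rintegral _ _ _ mu D (fun y => w y) alpha
  measurable_D mu_D_fin measurable_w w01 alpha0.
have int_f := integrable_powR_onem_w alpha (ltW alpha0).
rewrite RintegralB//.
rewrite -cvg_shiftS in c1.
rewrite (_ : series _ = fun N => \int[mu]_(y in D) 1 -
    series (fun n => (-1) ^+ n * gbinom alpha n * \int[mu]_(y in D) (w y ^+
      n)) N.+1).
  by apply: cvgB; [exact: cvg_cst|exact: c1].
apply/funext => N; rewrite /series/= big_nat_recl//= gbinom0 expr0 !mul1r.
have -> : \int[mu]_(y in D) (w y ^+ 0) = \int[mu]_(y in D) 1.
  by apply: eq_Rintegral => y _; rewrite expr0.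
rewrite opprD addrA subrr add0r -sumrN; apply: eq_bigr => n _.
have -> : \int[mu]_(y in D) (w y ^+ n.+1) =
    \int[mu]_(y in D) ((1 - u y) `^ (n.+1%:R / beta)).
  by apply: eq_Rintegral => y _; rewrite -powR_mulrn ?powR_ge0// -powRrM mulrC.
have -> : gbinom alpha n.+1 = alpha * gbinom (alpha - 1) n / n.+1%:R.
  by rewrite -gbinomSS; field; rewrite nat1r.
by rewrite exprS; ring.
Qed.

Lemma expectation_expr_eglfr d (T : measurableType d) (P : probability T R)
    (X : {RV P >-> R}) (alpha : R) : 0 < alpha -> has_eglfr X alpha beta a b ->
  ('E_P[fun w => (X w ^+ r)%R] =
  (\int[mu]_(y in D) (1 - (1 - (1 - u y) `^ beta^-1) `^ alpha))%:E)%E.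
Proof.
move=> alpha0 hX; rewrite expectation_expr_ccdf//;
  last by rewrite hX /eglfr_cdf lexx.
rewrite [RHS]fineK; last first.
  apply: integrable_fin_num => //.
  exact: integrable_survival (ltW alpha0).
rewrite [LHS]integral_mkcond [RHS]integral_mkcond; apply: eq_integral => y _.
rewrite !patchE !mem_setE /= !in_itv/= andbT.
have [y0|//] := leP 0 y; rewrite /= ccdf_1_cdf hX -EFinB.
have x0 : 0 <= y `^ r%:R^-1 by exact: powR_ge0.
have [ypsi|psiy] := leP y (psi ^+ r).
  have /andP[_ xpsi] : 0 <= y `^ r%:R^-1 <= psi.
    by apply: root_itv; rewrite /= in_itv/= y0.
  move: (y `^ r%:R^-1) x0 xpsi => x x0 xpsi; congr (1 - _)%:E.
  (* The closed formula extends to both endpoints: [u = 0] gives the value [0], and [u = 1] gives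
     the value [1]. *)
  rewrite /eglfr_cdf; have [xle0|xgt0] := leP x 0.
    have -> : x = 0 by apply/le_anti; rewrite xle0 x0.
    by rewrite horner_hazard_poly expr0n !mulr0 addr0 mulr0 subr0 powR1 subrr
      powR0// gt_eqF.
  case: ltP => [_|psix]; first by rewrite horner_hazard_poly.
  have -> : x = psi by apply/le_anti; rewrite xpsi psix.
  by rewrite horner_hazard_poly_psi// subrr powR0 ?gt_eqF ?invr_gt0// subr0
    powR1.
(* Beyond [psi ^+ r] the root lies past the support, so the survival function is [0], as is the
   integrand extended by zero. *)
have psix : psi < y `^ r%:R^-1.
  have -> : psi = (psi ^+ r) `^ r%:R^-1.
    by rewrite -powR_mulrn ?ltW// -powRrM divff// powRr1// ltW.
  by rewrite gt0_ltr_powR ?invr_gt0 ?ltr0n ?nnegrE ?exprn_ge0// ltW.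
rewrite /eglfr_cdf !ifN -?leNgt -?ltNge ?subrr//; first exact: ltW.
exact: lt_trans psix.
Qed.

End eglfr_integrals.

Theorem theorem3p1 (d : measure_display) (T : measurableType d) (R : realType)
    (P : probability T R) (X : {RV P >-> R}) (alpha beta a b : R) (r : nat)
    (alpha_gt0 : 0 < alpha) (beta_gt0 : 0 < beta) (a_ge0 : 0 <= a)
    (b_gt0 : 0 < b) (r_gt0 : (0 < r)%N)
    (X_eglfr : has_eglfr X alpha beta a b) :
  let inner n : R^nat :=
    fun m => \sum_(0 <= k < m.+1) eglfr_term alpha beta a b r n m k in
  let outer : R^nat := fun n => limn (series (inner n)) in
  [/\ forall n, cvgn (series (inner n)),
      cvgn (series outer) &
      'E_P[fun w => (X w ^+ r)%R]%E = (limn (series outer))%:E].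
Proof.
move=> inner outer.
(* [J n] is the integral of [w ^+ n.+1], the quantity that the sum over [m] expands in powers of
   [u]. *)
pose J n := \int[lebesgue_measure]_(y in `[0, eglfr_psi beta a b ^+ r])
  ((1 - (hazard_poly beta a b).[y `^ r%:R^-1]) `^ (n.+1%:R / beta)).
have cvg_inner n : series (inner n) @ \oo -->
    alpha * ((-1) ^+ n * gbinom (alpha - 1) n) * (J n / n.+1%:R).
  rewrite (_ : series _ = fun M => alpha * ((-1) ^+ n * gbinom (alpha - 1) n) *
    series (fun m => (-1) ^+ m * gbinom (n.+1%:R / beta - 1) m *
      hazard_moment a b (eglfr_psi beta a b) beta r m) M).
    by apply: cvgMl_tmp; exact: cvg_series_inner.
  apply/funext => M; rewrite /series/= mulr_sumr; apply: eq_bigr => m _.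
  exact: hazard_momentE.
have outerE : outer = fun n =>
    alpha * ((-1) ^+ n * gbinom (alpha - 1) n) * (J n / n.+1%:R).
  by apply/funext => n; apply/cvg_lim => //; exact: cvg_inner.
have cvg_outer := cvg_series_outer beta a b r beta_gt0 a_ge0 b_gt0 r_gt0 alpha
  alpha_gt0.
rewrite -outerE in cvg_outer.
split.
- by move=> n; apply/cvg_ex; eexists; exact: cvg_inner.
- by apply/cvg_ex; eexists; exact: cvg_outer.
- rewrite (expectation_expr_eglfr beta a b r beta_gt0 a_ge0 b_gt0 r_gt0 _ _ _
  _ alpha)//.
  by congr EFin; apply/esym/cvg_lim.
Qed.
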